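(* Let $(n_0,\ldots,n_m)$ be an architecture. For every $k\in\mathbb{N}$, the set $$\left\{\theta\in\mathcal{P}_{n_0,\ldots,n_m} : \theta\text{ is ordinary and }\dim_{\mathrm{fun}}(\theta)\geq k\right\}$$ is an open subset of $\mathcal{P}_{n_0,\ldots,n_m}$.
   Context: An architecture is a tuple $(n_0,\ldots,n_m)$ of positive integers with $m\ge 1$. Let $\sigma$ denote the map applying $t\mapsto\max\{0,t\}$ to each coordinate of a vector in any $\mathbb{R}^n$. Put $D(n_0,\ldots,n_m)=\sum_{i=1}^m n_i(n_{i-1}+1)$ and $\mathcal{P}_{n_0,\ldots,n_m}=\mathbb{R}^{D(n_0,\ldots,n_m)}$ (parameter space). A parameter $\theta\in\mathcal{P}_{n_0,\ldots,n_m}$ is identified with a list of matrices $[A^i]$ of size $n_i\times(n_{i-1}+1)$, $1\le i\le m$, giving affine maps $A^i:\mathbb{R}^{n_{i-1}}\to\mathbb{R}^{n_i}$, $A^i(x)=[A^i][x,1]^T$. The realization map $\rho$ sends $\theta$ to the function $\rho(\theta)=\sigma\circ A^m\circ\cdots\circ\sigma\circ A^1:\mathbb{R}^{n_0}\to\mathbb{R}^{n_m}$. Let $\mathcal{F}(\theta,x)=\rho(\theta)(x)$. A point $x\in\mathbb{R}^{n_0}$ is parametrically smooth for $\theta$ if $\mathcal{F}:\mathcal{P}_{n_0,\ldots,n_m}\times\mathbb{R}^{n_0}\to\mathbb{R}^{n_m}$ is $C^\infty$ at $(\theta,x)$ (i.e. on a neighborhood of it). A finite set $Z\subset\mathbb{R}^{n_0}$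 is parametrically smooth for $\theta$ if all its points are. A parameter $\theta$ is ordinary if at least one point of $\mathbb{R}^{n_0}$ is parametrically smooth for $\theta$. For a finite ordered set $Z=\{z_1,\ldots,z_k\}\subset\mathbb{R}^{n_0}$, the evaluation map $E_Z:\mathcal{P}_{n_0,\ldots,n_m}\to\mathbb{R}^{k n_m}$ is $E_Z(\theta)=(\rho(\theta)(z_1),\ldots,\rho(\theta)(z_k))$, and $\mathbf{J}E_Z|_\theta$ is its Jacobian matrix with respect to the parameter coordinates at $\theta$. The functional dimension of an ordinary parameter $\theta$ is $$\dim_{\mathrm{fun}}(\theta)=\sup\{\operatorname{rank}\mathbf{J}E_Z|_\theta : Z\subset\mathbb{R}^{n_0}\text{ finite and parametrically smooth for }\theta\}.$$ *)

(* Defs.v *)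
From mathcomp Require Import all_boot all_order all_algebra.
From mathcomp Require Import all_classical all_reals all_analysis.

Set Implicit Arguments.
Unset Strict Implicit.
Unset Printing Implicit Defensive.

Import Order.TTheory GRing.Theory Num.Theory.
Import numFieldNormedType.Exports.

Local Open Scope classical_set_scope.
Local Open Scope ring_scope.

(* R^n is 'rV[R]_n throughout, as for the library's jacobian.                *)

(* f is C^k on U, where U is meant to be open (so that the values of f       *)
(* outside U are irrelevant to its derivatives at points of U).              *)
Fixpoint class_C (R : realType) (V W : normedModType R) (k : nat)
    (f : V -> W) (U : set V) : Prop :=
  if k is k'.+1 then
    (forall x, U x -> differentiable f x) /\
    (forall v : V, class_C k' (fun x => 'D_v f x) U)
  else forall x, U x -> {for x, continuous f}.

Definition smooth_at (R : realType) (V W : normedModType R)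
    (f : V -> W) (p : V) : Prop :=
  exists U : set V, [/\ open U, U p & forall k, class_C k f U].

(* The architecture (n_0, ..., n_m) is the restriction to {0, ..., m} of     *)
(* n : nat -> nat; the values n i for i > m are never used.                  *)
Definition architecture (m : nat) (n : nat -> nat) : Prop :=
  (0 < m)%N /\ forall i, (i <= m)%N -> (0 < n i)%N.

Definition param_dim (m : nat) (n : nat -> nat) : nat :=
  (\sum_(i < m) n i.+1 * (n i + 1))%N.

Definition relu (R : realType) (d : nat) (x : 'rV[R]_d) : 'rV[R]_d :=
  map_mx (Num.max 0) x.

Definition affine (R : realType) (p q : nat) (A : 'M[R]_(q, p + 1))
    (x : 'rV[R]_p) : 'rV[R]_q :=
  (A *m (row_mx x 1%:M)^T)^T.

(* Layers are indexed from 0, so layer theta i is the matrix [A^(i+1)]; the  *)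
(* blocks of theta are consecutive and each is read in row-major order.      *)
Definition layer (R : realType) (m : nat) (n : nat -> nat)
    (theta : 'rV[R]_(param_dim m n)) (i : 'I_m) : 'M[R]_(n i.+1, n i + 1) :=
  vec_mx (@submxrow R m (fun j : 'I_m => n j.+1 * (n j + 1))%N 1 theta i).

Fixpoint network (R : realType) (n : nat -> nat) (m : nat) :
    (forall i : 'I_m, 'M[R]_(n i.+1, n i + 1)) -> 'rV[R]_(n 0%N) ->
    'rV[R]_(n m) :=
  match m with
  | 0 => fun _ x => x
  | m'.+1 => fun A x =>
      relu (affine (A ord_max)
        (network (fun i : 'I_m' => A (widen_ord (leqnSn m') i)) x))
  end.

Definition realization (R : realType) (m : nat) (n : nat -> nat)
    (theta : 'rV[R]_(param_dim m n)) : 'rV[R]_(n 0%N) -> 'rV[R]_(n m) :=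
  network (layer theta).

Definition param_smooth (R : realType) (m : nat) (n : nat -> nat)
    (theta : 'rV[R]_(param_dim m n)) (x : 'rV[R]_(n 0%N)) : Prop :=
  smooth_at (fun p : 'rV[R]_(param_dim m n) * 'rV[R]_(n 0%N) =>
    realization p.1 p.2) (theta, x).

Definition param_smooth_set (R : realType) (m : nat) (n : nat -> nat)
    (theta : 'rV[R]_(param_dim m n)) (Z : seq 'rV[R]_(n 0%N)) : Prop :=
  forall z, z \in Z -> param_smooth theta z.

Definition ordinary (R : realType) (m : nat) (n : nat -> nat)
    (theta : 'rV[R]_(param_dim m n)) : Prop :=
  exists x : 'rV[R]_(n 0%N), param_smooth theta x.

Definition evaluation (R : realType) (m : nat) (n : nat -> nat)
    (Z : seq 'rV[R]_(n 0%N)) (theta : 'rV[R]_(param_dim m n)) :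
    'rV[R]_(size Z * n m) :=
  mxvec (\matrix_(j < size Z) realization theta (tnth (in_tuple Z) j)).

(* The library's jacobian acts on row vectors from the right: it is the      *)
(* transpose of the usual Jacobian matrix, hence of the same rank.           *)
Definition dim_fun (R : realType) (m : nat) (n : nat -> nat)
    (theta : 'rV[R]_(param_dim m n)) : \bar R :=
  ereal_sup [set ((\rank (jacobian (evaluation Z) theta))%:R)%:E
            | Z in [set Z : seq 'rV[R]_(n 0%N) |
                    uniq Z /\ param_smooth_set theta Z]].

(* Main.v *)
(* A fixed finite set Z witnessing rank at least k at theta keeps witnessing it
   nearby: parametric smoothness of a point is an open condition on theta, so Z
   stays parametrically smooth and E_Z is continuously differentiable near
   theta, and the rank of a matrix is lower semicontinuous. *)
Require Import Defs.
From mathcomp Require Import all_boot all_order all_algebra.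
From mathcomp Require Import all_classical all_reals all_analysis.

Import Order.TTheory GRing.Theory Num.Theory.
Import numFieldNormedType.Exports.

Local Open Scope classical_set_scope.
Local Open Scope ring_scope.

Lemma cvg_mx {T : Type} {U : topologicalType} (m n : nat) (F : set_system T)
    (A : T -> 'M[U]_(m, n)) (a : 'M[U]_(m, n)) :
  Filter F -> (forall i j, A x i j @[x --> F] --> a i j) -> A @ F --> a.
Proof.
move=> FF Aa B [P aP PB].
have : \forall x \near F, forall i j, P i j (A x i j).
  by apply: filter_forall => i; apply: filter_forall => j; exact: (Aa i j _ (aP i j)).
by apply: filterS => x Px; exact: PB.
Qed.

Lemma cvg_coord {T : Type} {R : numFieldType} (m n : nat) (F : set_system T)
    (A : T -> 'M[R]_(m, n)) (a : 'M[R]_(m, n)) i j :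
  A @ F --> a -> A x i j @[x --> F] --> a i j.
Proof.
move=> Aa; apply: (cvg_comp A (fun M : 'M[R]_(m, n) => M i j) Aa).
exact: coord_continuous.
Qed.

Lemma cvg_mulmx {T : Type} {R : numFieldType} (m n p : nat) (F : set_system T)
    (A : T -> 'M[R]_(m, n)) (B : T -> 'M[R]_(n, p))
    (a : 'M[R]_(m, n)) (b : 'M[R]_(n, p)) :
  Filter F -> A @ F --> a -> B @ F --> b ->
  A x *m B x @[x --> F] --> a *m b.
Proof.
move=> FF Aa Bb; apply: cvg_mx => i j; rewrite mxE.
under eq_cvg do rewrite mxE.
apply: cvg_big; first exact: add_continuous.
by move=> k _; apply: cvgM; exact: cvg_coord.
Qed.

Lemma cvg_det {T : Type} {R : numFieldType} (n : nat) (F : set_system T)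
    (A : T -> 'M[R]_n) (a : 'M[R]_n) :
  Filter F -> A @ F --> a -> \det (A x) @[x --> F] --> \det a.
Proof.
move=> FF Aa; rewrite /determinant.
apply: cvg_big => [|s _]; first exact: add_continuous.
apply: cvgMr; apply: cvg_big => [|i _]; first exact: mul_continuous.
exact: cvg_coord.
Qed.

(** Lower semicontinuity of rank. Fixed matrices [P] and [Q] compress [a] to the identity of size
    [r]. The determinant of the compressed [A x] tends to 1, so it is eventually nonzero, and a
    factor of an invertible matrix of size [r] has rank at least [r]. *)
Lemma near_mxrank_ge {T : Type} {R : numFieldType} (m n : nat)
    (F : set_system T) (A : T -> 'M[R]_(m, n)) (a : 'M[R]_(m, n)) :
  Filter F -> A @ F --> a -> \forall x \near F, (\rank a <= \rank (A x))%N.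
Proof.
move=> FF Aa; set r := \rank a.
(* Since [a = col_ebase a *m pid_mx r *m row_ebase a] with invertible outer factors, [P] and [Q]
   invert these factors and truncate to [r] rows and [r] columns. *)
pose P : 'M[R]_(r, m) := pid_mx r *m invmx (col_ebase a).
pose Q : 'M[R]_(n, r) := invmx (row_ebase a) *m pid_mx r.
have PaQ : P *m a *m Q = 1%:M.
  rewrite -[in X in P *m X](mulmx_ebase a) /P /Q !mulmxA.
  rewrite mulmxKV ?col_ebase_unit // mulmxK ?row_ebase_unit //.
  rewrite !pid_mx_id ?pid_mx_1 // ?rank_leq_row ?rank_leq_col //.
have : \det (P *m A x *m Q) @[x --> F] --> (1 : R).
  rewrite -(det1 R r) -PaQ; apply: cvg_det; apply: cvg_mulmx; last exact: cvg_cst.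
  by apply: cvg_mulmx => //; exact: cvg_cst.
move=> /cvgr_neq0 /(_ (oner_neq0 _)); apply: filterS => x detn0.
have PAQ_unit : P *m A x *m Q \in unitmx by rewrite unitmxE unitfE.
rewrite -(mxrank_unit PAQ_unit).
exact: leq_trans (mxrankM_maxl _ _) (mxrankM_maxr _ _).
Qed.

Lemma differentiable_mx {R : numFieldType} {V : normedModType R} (m n : nat)
    (M : V -> 'M[R]_(m, n)) t :
  (forall i j, differentiable (fun x => M x i j) t) -> differentiable M t.
Proof.
move=> dM.
(* Scalar functions times constant basis matrices reduce the claim to the entries. *)
rewrite (_ : M = \sum_i \sum_j (fun x => M x i j *: delta_mx i j)).
  by do 2 (apply: differentiable_sum => ?); apply: differentiableZl.
apply/funext => x; rewrite [LHS]matrix_sum_delta fct_sumE.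
by apply: eq_bigr => i _; rewrite fct_sumE.
Qed.

Lemma jacobianE {R : realFieldType} (p q : nat)
    (f : 'rV[R]_p -> 'rV[R]_q) t i l :
  differentiable f t ->
  jacobian f t i l = 'D_(delta_mx 0 i) (fun s => f s 0 l) t.
Proof.
move=> df.
have -> : jacobian f t i l = ('D_(delta_mx 0 i) f t) 0 l.
  by rewrite deriveEjacobian // -rowE [RHS]mxE.
by rewrite derive_mx ?mxE //; apply: diff_derivable.
Qed.

(** The two difference quotients are the same function of [h], because moving along [(v, 0)] leaves
    [z] fixed. This carries regularity in the pair (parameter, point) over to the parameter
    alone. *)
Lemma derive_pairl {R : numFieldType} {V W X : normedModType R}
    (f : V * W -> X) (t v : V) (z : W) :
  'D_v (fun s => f (s, z)) t = 'D_(v, 0) f (t, z).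
Proof.
suff E : (fun h : R => h^-1 *: (((fun s => f (s, z)) \o shift t) (h *: v) - f (t, z))) =
    (fun h : R => h^-1 *: ((f \o shift (t, z)) (h *: ((v, 0) : V * W)) - f (t, z))).
  by rewrite /derive E.
apply/funext => h /=; do 3 f_equal.
by rewrite [RHS]surjective_pairing /= scaler0 add0r.
Qed.

Lemma differentiable_pairl {R : numFieldType} {V W X : normedModType R}
    (f : V * W -> X) (t : V) (z : W) :
  differentiable f (t, z) -> differentiable (fun s => f (s, z)) t.
Proof.
move=> df; apply: (@differentiable_comp _ _ _ _ (fun s => (s, z)) f _ _ df).
exact: differentiable_pair.
Qed.

Lemma continuous_pairl {U V : topologicalType} (y : V) :
  continuous (fun x : U => (x, y)).
Proof. by move=> x; apply: cvg_pair; [exact: cvg_id | exact: cvg_cst]. Qed.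

Section evaluation.
Context {R : realType} {m : nat} {n : nat -> nat}.
Implicit Types (theta : 'rV[R]_(param_dim m n)) (Z : seq 'rV[R]_(n 0)).

Local Notation F := (fun p : 'rV[R]_(param_dim m n) * 'rV[R]_(n 0) =>
  realization p.1 p.2).

Lemma evaluation_coord Z j c :
  (fun theta => evaluation Z theta 0 (mxvec_index j c)) =
  (fun theta => realization theta (tnth (in_tuple Z) j) 0 c).
Proof. by apply/funext => theta; rewrite /evaluation mxvecE mxE. Qed.

(** The open set [U] witnessing smoothness at [(theta, x)] also contains [(t, x)] for [t] near
    [theta], and serves as witness there unchanged. *)
Lemma param_smooth_near theta x :
  param_smooth theta x -> \forall t \near theta, param_smooth t x.
Proof.
move=> [U [oU Ux CU]].
have : \forall t \near theta, U (t, x).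
  by apply: (continuous_pairl x theta U); exact: open_nbhs_nbhs.
by apply: filterS => t Ut; exists U.
Qed.

Lemma param_smooth_differentiable theta x :
  param_smooth theta x -> differentiable (fun t => realization t x) theta.
Proof.
(* [class_C 1] has two halves: differentiability on [U], used here, and continuity of every
   directional derivative, used in the next lemma. *)
move=> [U [_ Ux /(_ 1%N) [dU _]]].
exact: (@differentiable_pairl _ _ _ _ F _ _ (dU _ Ux)).
Qed.

Lemma param_smooth_derive_continuous theta x v :
  param_smooth theta x ->
  {for theta, continuous ('D_v (fun t => realization t x))}.
Proof.
move=> [U [_ Ux /(_ 1%N) [_ /(_ (v, 0)) /(_ _ Ux) cD]]].
have -> : 'D_v (fun t => realization t x) = fun t => 'D_(v, 0) F (t, x).
  by apply/funext => t; exact: (@derive_pairl _ _ _ _ F).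
apply: (@continuous_comp _ _ _ (fun t => (t, x)) ('D_(v, 0) F)) cD.
exact: continuous_pairl.
Qed.

Lemma differentiable_evaluation Z theta :
  param_smooth_set theta Z -> differentiable (evaluation Z) theta.
Proof.
move=> sZ; apply: differentiable_mx => i l; rewrite (ord1 i) {i}.
case/mxvec_indexP: l => j c.
rewrite evaluation_coord.
apply: (@differentiable_comp _ _ _ _ _ (fun N : 'rV[R]_(n m) => N 0 c)).
  by apply/param_smooth_differentiable/sZ; exact: mem_tnth.
exact: differentiable_coord.
Qed.

Lemma param_smooth_set_near theta Z :
  param_smooth_set theta Z -> \forall t \near theta, param_smooth_set t Z.
Proof.
move=> sZ.
have : \forall t \near theta,
    forall j : 'I_(size Z), param_smooth t (tnth (in_tuple Z) j).
  apply: (@filter_forall _ _ (fun j t => param_smooth t (tnth (in_tuple Z) j))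
    (nbhs theta) _) => j.
  by apply/param_smooth_near/sZ; exact: mem_tnth.
by apply: filterS => t st z /(@tnthP _ _ (in_tuple Z)) [j ->].
Qed.

(** Each entry of the Jacobian is a coordinate of a directional derivative of the realization at one
    point of [Z], and that derivative is continuous at [theta]. *)
Lemma jacobian_evaluation_continuous Z theta :
  param_smooth_set theta Z ->
  {for theta, continuous (jacobian (evaluation Z))}.
Proof.
move=> sZ; apply: (@cvg_mx _ _ _ _ (nbhs theta)) => i l; case/mxvec_indexP: l => j c.
set z := tnth (in_tuple Z) j.
pose D t : R := ('D_(delta_mx 0 i) (fun s => realization s z) t) 0 c.
have zZ : z \in Z by exact: mem_tnth.
(* The identification rests on differentiability of the evaluation at [t]. It is therefore obtained
   only where [Z] is smooth, which suffices because this holds near [theta] and limits are local. *)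
have JE t : param_smooth_set t Z ->
    jacobian (evaluation Z) t i (mxvec_index j c) = D t.
  move=> st; rewrite jacobianE; last exact: differentiable_evaluation.
  rewrite evaluation_coord.
  rewrite /D derive_mx ?mxE //.
  exact/diff_derivable/param_smooth_differentiable/st.
have cD : {for theta, continuous D}.
  by apply: cvg_coord; exact/param_smooth_derive_continuous/sZ.
have nearJD : \forall t \near theta,
    D t = jacobian (evaluation Z) t i (mxvec_index j c).
  by apply: filterS (param_smooth_set_near _ _ sZ) => t st; rewrite (JE t st).
apply: cvg_trans (near_eq_cvg nearJD) _.
exact: (eq_ind_r (fun a => D @ theta --> a) cD (JE theta sZ)).
Qed.

(** The supremum is over integers: if it is at least [k], it exceeds [k.-1], so some rank exceeds
    [k.-1] and is thus at least [k]. Positivity of [k] gives [k.-1 < k]. *)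
Lemma dim_fun_geP theta (k : nat) : (0 < k)%N ->
  (k%:R%:E <= dim_fun theta)%E <->
  exists Z, [/\ uniq Z, param_smooth_set theta Z &
                (k <= \rank (jacobian (evaluation Z) theta))%N].
Proof.
move=> k0; split => [kd|[Z [uZ sZ kZ]]]; last first.
  apply: le_trans (ereal_sup_ubound _); last by exists Z.
  by rewrite lee_fin ler_nat.
have : ((k.-1%:R : R)%:E < dim_fun theta)%E.
  by apply: lt_le_trans kd; rewrite lte_fin ltr_nat ltn_predL.
move=> /ereal_sup_gt [_ [Z [uZ sZ] <-]].
by rewrite lte_fin ltr_nat prednK // => kZ; exists Z.
Qed.

Lemma dim_fun_ge0 theta : (0 <= dim_fun theta)%E.
Proof.
(* The empty list is vacuously smooth, so the supremum is over a nonempty set and cannot be the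
   value minus infinity. *)
apply: le_trans (ereal_sup_ubound _); last by exists [::].
by rewrite lee_fin ler0n.
Qed.

End evaluation.

Theorem theorem10p2 (R : realType) (m : nat) (n : nat -> nat)
    (arch : architecture m n) (k : nat) :
  open [set theta : 'rV[R]_(param_dim m n) |
        ordinary theta /\ (k%:R%:E <= dim_fun theta)%E].
Proof.
rewrite openE => theta [[x sx] kd]; rewrite /interior.
have ord_near : \forall t \near theta, ordinary t.
  by apply: filterS (param_smooth_near _ _ sx) => t st; exists x.
(* For [k = 0] the bound on the functional dimension always holds, and only openness of being
   ordinary remains. *)
have [->|k0] := posnP k.
  by apply: filterS ord_near => t ot; split; [exact: ot | exact: dim_fun_ge0].
have [Z [uZ sZ kZ]] := (dim_fun_geP theta _ k0).1 kd.
have rk_near : \forall t \near theta, (\rank (jacobian (evaluation Z) theta)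
    <= \rank (jacobian (evaluation Z) t))%N.
  exact: near_mxrank_ge (jacobian_evaluation_continuous _ _ sZ).
apply: (filterS3 _ _ ord_near (param_smooth_set_near _ _ sZ) rk_near).
move=> t ot st rk_t; split; first exact: ot.
apply: (dim_fun_geP t k k0).2.
by exists Z; split; [exact: uZ | exact: st | exact: leq_trans rk_t].
Qed.
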